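(* Let $\mathcal{I},\mathcal{J}_1,\mathcal{J}_2$ be operator ideals such that $\mathcal{J}_1$ has the Grothendieck property, $\mathcal{I}\supseteq\mathcal{L}_{\mathcal{J}_1}=\mathcal{L}_{\mathcal{J}_1}\circ\mathcal{L}_{\mathcal{J}_2}$, and such that operators belonging to $\mathcal{I}$ map $\mathcal{J}_2$-bounded sets to $\mathcal{J}_1$-bounded sets. The following statements are equivalent for a Banach space $E$: (a) $\mathrm{id}_E\in\overline{\mathcal{F}(E;E)}^{\,\tau_{C_{\mathcal{J}_1}}}$. (b) $E$ has the $(\mathcal{L}_{\mathcal{J}_1},\mathcal{F},\|\cdot\|)$-AP. (c) $E$ has the $(\mathcal{L}_{\mathcal{J}_1},\mathcal{F},\tau_{C_{\mathcal{J}_2}})$-AP. (d) $E$ has the $(\mathcal{I},\mathcal{F},\tau_{C_{\mathcal{J}_2}})$-AP.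
   Context: All Banach spaces are over $\mathbb{K}=\mathbb{R}$ or $\mathbb{C}$; $\mathcal{L}(E;F)$ is the space of bounded linear operators, $B_E$ the closed unit ball of $E$, $\mathrm{id}_E$ the identity operator. Operator ideals are in the sense of Pietsch: a class $\mathcal{I}$ of bounded operators such that each component $\mathcal{I}(E;F)$ is a linear subspace of $\mathcal{L}(E;F)$ containing the finite rank operators, and $w\circ v\circ u\in\mathcal{I}$ whenever $v\in\mathcal{I}$ and $u,w$ are bounded operators (composable). $\mathcal{F}$ denotes the ideal of finite rank bounded operators. $\mathcal{I}\circ\mathcal{J}$ is the class of operators $R\circ S$ with $R\in\mathcal{I}$, $S\in\mathcal{J}$. $\overline{A}^{\,\tau}$ is closure with respect to $\tau$, and $\|\cdot\|$ as a topology is the operator norm topology. For an operator ideal $\mathcal{J}$ and a Banach space $E$, the $\mathcal{J}$-bounded subsets of $E$ form the collection $C_{\mathcal{J}}(E)=\{A\subseteq E:\ \exists\text{ a Banach space }F\text{ and }u\in\mathcal{J}(F;E)\text{ with }A\subseteq u(B_F)\}$. $\tau_{C_{\mathcal{J}}}$ is the topology on each $\mathcal{L}(E;F)$ of uniform convergence on $\mathcal{J}$-bounded subsets of $E$ (generated by the seminorms $u\mapsto\sup_{x\in A}\|u(x)\|$, $A\in C_{\mathcal{J}}(E)$). $\mathcal{L}_{\mathcal{J}}$ is the operator ideal of $\mathcal{J}$-bounded operators: $T\in\mathcal{L}_{\mathcal{J}}(E;F)$ if every $x\in E$ has a neighborhood $V_x$ with $T(V_x)\in C_{\mathcal{J}}(F)$;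 equivalently, $T(B_E)\in C_{\mathcal{J}}(F)$. An operator ideal $\mathcal{J}$ has the Grothendieck property if whenever $A$ is a bounded subset of a Banach space $E$ such that for every $\varepsilon>0$ there is $A_\varepsilon\in C_{\mathcal{J}}(E)$ with $A\subseteq A_\varepsilon+\varepsilon B_E$, it holds that $A\in C_{\mathcal{J}}(E)$. For operator ideals $\mathcal{I},\mathcal{J}$ and a topology $\tau$ assigned to all spaces $\mathcal{L}(F;E)$, a Banach space $E$ has the $(\mathcal{I},\mathcal{J},\tau)$-approximation property ($(\mathcal{I},\mathcal{J},\tau)$-AP) if $\mathcal{I}(F;E)\subseteq\overline{\mathcal{J}(F;E)}^{\,\tau}$ for every Banach space $F$. *)

(* Defs.v *)
From HB Require Import structures.
From mathcomp Require Import all_boot all_order all_algebra.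
From mathcomp Require Import all_classical all_reals all_analysis.
From mathcomp Require Import complex.
Import Order.TTheory GRing.Theory Num.Theory.
Import numFieldNormedType.Exports.

Set Implicit Arguments.
Unset Strict Implicit.
Unset Printing Implicit Defensive.

Local Open Scope classical_set_scope.
Local Open Scope ring_scope.

(* The scalars are an abstract numFieldType K, so that the Banach spaces over K
   are the inhabitants of completeNormedModType K. Norms take values in K; for
   K = R[i] the order is the partial one, in which 0 <= e says that e is a
   nonnegative real. *)
Definition real_or_complex (K : numFieldType) : Prop :=
  exists R : realType, K = R :> numFieldType \/ K = R[i] :> numFieldType.

Section BoundedOperators.
Context {K : numFieldType}.

Definition bounded_operator_pred (E F : normedModType K) : {pred E -> F} :=
  fun f => `[< linear f /\ exists M : K, forall x, `|f x| <= M * `|x| >].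

Record bounded_operator (E F : normedModType K) := BoundedOperator {
  operator_fun :> E -> F ;
  operator_funP : operator_fun \in @bounded_operator_pred E F }.

Section Structure.
Variables E F : normedModType K.

HB.instance Definition _ :=
  [isSub of bounded_operator E F for @operator_fun E F].
HB.instance Definition _ := [Choice of bounded_operator E F by <:].

Fact bounded_operator_submod_closed :
  submod_closed (@bounded_operator_pred E F).
Proof.
split=> [|a f g /asboolP[lf [M fM]] /asboolP[lg [N gN]]]; apply/asboolP.
  split=> [b x y|]; first by rewrite -[0 _]/0 -[0 x]/0 -[0 y]/0 scaler0 addr0.
  by exists 0 => x; rewrite -[0 x]/0 normr0 mul0r.
have afgE x : (a *: f + g) x = a *: f x + g x by [].
split=> [b x y|].
  by rewrite !afgE lf lg !scalerDr !scalerA mulrC addrACA.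
exists (`|a| * M + N) => x; rewrite afgE mulrDl -mulrA.
by rewrite (le_trans (ler_normD _ _))// lerD// normrZ ler_wpM2l.
Qed.

HB.instance Definition _ := GRing.isSubmodClosed.Build K (E -> F)
  (@bounded_operator_pred E F) bounded_operator_submod_closed.
HB.instance Definition _ :=
  [SubChoice_isSubLmodule of bounded_operator E F by <:].

End Structure.

Fact id_operator_subproof (E : normedModType K) :
  idfun \in @bounded_operator_pred E E.
Proof. by apply/asboolP; split=> //; exists 1 => x; rewrite mul1r. Qed.

Definition id_operator (E : normedModType K) : bounded_operator E E :=
  BoundedOperator (@id_operator_subproof E).

Fact comp_operator_subproof (E F G : normedModType K)
    (v : bounded_operator F G) (u : bounded_operator E F) :
  v \o u \in @bounded_operator_pred E G.
Proof.
have /asboolP[lu [M uM]] := operator_funP u.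
have /asboolP[lv [N vN]] := operator_funP v.
apply/asboolP; split=> [a x y|]; first by rewrite /= lu lv.
exists (`|N| * M) => x; rewrite -mulrA.
have Nux : `|v (u x)| <= `|N| * `|u x|.
  rewrite -[X in _ * X]normr_id -normrM ger0_norm ?vN//.
  exact: le_trans (vN _).
by apply: le_trans Nux _; rewrite ler_wpM2l.
Qed.

Definition comp_operator (E F G : normedModType K)
    (v : bounded_operator F G) (u : bounded_operator E F) :
    bounded_operator E G :=
  BoundedOperator (comp_operator_subproof v u).

Definition unit_ball (E : normedModType K) : set E := [set x | `|x| <= 1].

(* The supremum is that of the order of K: if K is real or complex and u is
   bounded on A, it is the usual real number (0 if A is empty). *)
Definition sup_seminorm (E F : normedModType K) (A : set E)
    (u : bounded_operator E F) : K :=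
  supremum 0 [set `|u x| | x in A].

Definition operator_norm (E F : normedModType K) : bounded_operator E F -> K :=
  sup_seminorm (@unit_ball E).

End BoundedOperators.

Notation "''L' ( E , F )" := (bounded_operator E F)
  (at level 8, format "''L' ( E ,  F )") : type_scope.

Section SeminormTopology.
Context {K : numFieldType} {V : lmodType K}.

Definition seminorm_topology (P : set (V -> K)) : Type := V.

Definition seminorm_subbase (P : set (V -> K)) : set_system V :=
  [set B | exists p u (e : K),
     [/\ P p, 0 < e & B = [set v | p (v - u) < e]]].

HB.instance Definition _ (P : set (V -> K)) :=
  Choice.on (seminorm_topology P).
HB.instance Definition _ (P : set (V -> K)) :=
  isSubBaseTopological.Build (seminorm_topology P) (seminorm_subbase P) id.

End SeminormTopology.

Section OperatorIdeals.
Context {K : numFieldType}.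
Local Notation banach := (completeNormedModType K).

Definition operator_class := forall E F : banach, set 'L(E, F).

Definition finite_rank : operator_class := fun E F =>
  [set u | exists (n : nat) (y : 'I_n -> F),
     forall x, exists c : 'I_n -> K, u x = \sum_(i < n) c i *: y i].

Arguments finite_rank : clear implicits.

Record operator_ideal := OperatorIdeal {
  ideal_class :> operator_class ;
  ideal_linear : forall (E F : banach) (a : K) (u v : 'L(E, F)),
    ideal_class u -> ideal_class v -> ideal_class (a *: u + v) ;
  ideal_finite_rank : forall E F : banach,
    finite_rank E F `<=` @ideal_class E F ;
  ideal_comp : forall (E F G H : banach)
      (w : 'L(G, H)) (v : 'L(F, G)) (u : 'L(E, F)),
    ideal_class v -> ideal_class (comp_operator w (comp_operator v u)) }.

Definition comp_class (I J : operator_class) : operator_class := fun E F =>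
  [set T | exists (G : banach) (R : 'L(G, F)) (S : 'L(E, G)),
     [/\ I G F R, J E G S & T = comp_operator R S]].

(* bounded_subsets J E is C_J(E), bounded_class J is L_J and uniform_topology J
   is the topology of uniform convergence on C_J(E). *)
Definition bounded_subsets (J : operator_class) (E : banach) : set (set E) :=
  [set A | exists (F : banach) (u : 'L(F, E)),
     J F E u /\ A `<=` u @` @unit_ball K F].

Definition bounded_class (J : operator_class) : operator_class := fun E F =>
  [set T | forall x : E, exists2 V, nbhs x V & bounded_subsets J (T @` V)].

Definition grothendieck_property (J : operator_class) : Prop :=
  forall (E : banach) (A : set E), bounded_set A ->
    (forall e : K, 0 < e -> exists2 B, bounded_subsets J B &
       A `<=` [set x + e *: y | x in B & y in @unit_ball K E]) ->
    bounded_subsets J A.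

Definition operator_topology :=
  forall E F : banach, Topological 'L(E, F).

Definition norm_topology : operator_topology := fun E F =>
  Topological.on (seminorm_topology [set @operator_norm K E F]).

Definition uniform_topology (J : operator_class) : operator_topology :=
  fun E F => Topological.on (seminorm_topology
    [set @sup_seminorm K E F A | A in @bounded_subsets J E]).

Definition operator_closure (tau : operator_topology) (E F : banach)
    (A : set 'L(E, F)) : set 'L(E, F) :=
  @closure (Topological.Pack (tau E F)) A.

Definition approximation_property (I J : operator_class)
    (tau : operator_topology) (E : banach) : Prop :=
  forall F : banach, I F E `<=` operator_closure tau (J F E).

End OperatorIdeals.

Arguments operator_class : clear implicits.
Arguments operator_ideal : clear implicits.
Arguments operator_topology : clear implicits.
Arguments finite_rank {K} E F _.
Arguments ideal_class {K} I E F _ : rename.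
Arguments bounded_class {K} J E F _.
Arguments comp_class {K} I J E F _.
Arguments bounded_subsets {K} J E _.
Arguments operator_closure {K} tau E F A _.

(* Main.v *)
(* Only the passage from the operator norm approximation property to (a) is not
   formal. Given v in J1(F; E), let W = v(B_F) and let U be the set of x with
   d(x, W / t) <= t for all t > 0. The Grothendieck property makes the Banach
   disc U a J1-bounded set, and its gauge satisfies
   |v y|_U <= e |y| + |v y| / e for all e > 0. Approximate the inclusion E_U -> E
   in norm by a finite rank operator sum_i f_i (.) z_i. Each f_i o v is then
   dominated by e |y| + C |v y|, so that by Hahn-Banach some g_i in the dual of E
   satisfies |g_i (v y) - f_i (v y)| <= e |y|, and sum_i g_i (.) z_i is close to
   the identity on W. *)
From HB Require Import structures.
From mathcomp Require Import all_boot all_order all_algebra.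
From mathcomp Require Import all_classical all_reals all_analysis.
From mathcomp Require Import complex finmap.
From mathcomp Require Import lra.
Require Import Defs.
Import Order.TTheory GRing.Theory Num.Theory.
Import numFieldNormedType.Exports.

Set Implicit Arguments.
Unset Strict Implicit.
Unset Printing Implicit Defensive.

Local Open Scope classical_set_scope.
Local Open Scope ring_scope.

(** The set [W] itself would not do: a finite rank operator close to [v], or to the inclusion of the
    span of [W], has coefficient functionals controlled by [|y|] alone, and nothing relates them to
    functionals continuous on [E]. Tapering passes to a disc that absorbs [W] and whose gauge at
    [v y] is controlled by [|v y|] up to an arbitrarily small multiple of [|y|]. The functional
    [f_i] is then not extended to [E] but replaced by [g_i], with an error that is small on the unit
    ball of [F]. The disc has to be closed, so that its span is complete under the gauge: the
    approximation property in (b) tests Banach spaces only. Norms take values in [K], whose order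
    may be partial, so every supremum and infimum is formed in the real field and carried back to
    [K]. *)

(** * The Hahn-Banach theorem for sublinear functionals *)

Section HahnBanach.
Context {R : realType} {K : numFieldType} {iota : R -> K}.
Hypothesis iotaB : {morph iota : x y / x - y}.
Hypothesis iotaM : {morph iota : x y / x * y}.
Hypothesis iota1 : iota 1 = 1.
Context {E : lmodType K}.

Let iota0 : iota 0 = 0. Proof. by rewrite -[X in iota X](subrr 0) iotaB subrr. Qed.
Let iotaN x : iota (- x) = - iota x.
Proof. by have := iotaB 0 x; rewrite iota0 !sub0r. Qed.
Let iotaD x y : iota (x + y) = iota x + iota y.
Proof. by rewrite -{1}[y]opprK iotaB iotaN opprK. Qed.

Definition sublinear (N : E -> R) :=
  (forall x y, N (x + y) <= N x + N y) /\
  (forall r x, 0 < r -> N (iota r *: x) = r * N x).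

Lemma sublinear0 N : sublinear N -> N 0 = 0.
Proof.
by case=> _ NZ; have := NZ 2 0 (ltr0Sn _ _); rewrite scaler0; lra.
Qed.

Lemma sublinear_ge N x : sublinear N -> - N (- x) <= N x.
Proof.
move=> sN; have := sublinear0 sN; have := sN.1 x (- x); rewrite subrr; lra.
Qed.

(** The functional [M x], the infimum over [t >= 0] of [N (x + t x0) - t N x0], is sublinear and
    lies below [N], so minimality gives [M = N]. The choice [x = - x0], [t = 1] yields
    [N (- x0) <= - N x0]; the reverse inequality is [sublinear_ge]. *)
Lemma minimal_sublinear_odd N : sublinear N ->
  (forall M, sublinear M -> (forall x, M x <= N x) -> M = N) ->
  forall x, N (- x) = - N x.
Proof.
move=> sN Nmin x0.
have [NA NZ] := sN.
pose S x := [set N (x + iota t *: x0) - t * N x0 | t in [set t | 0 <= t]].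
have N0 := sublinear0 sN.
have NZ0 r x : 0 <= r -> N (iota r *: x) = r * N x.
  by rewrite le_eqVlt => /predU1P[<-|/NZ//]; rewrite iota0 scale0r N0 mul0r.
have S_lb x : lbound (S x) (- N (- x)).
  move=> _ [t t0 <-].
  have := NA (x + iota t *: x0) (- x); rewrite addrC addKr NZ0//; lra.
have S_inf x : has_inf (S x).
  split; last by exists (- N (- x)).
  by exists (N (x + iota 0 *: x0) - 0 * N x0), 0 => /=.
pose M x := inf (S x).
have M_le x t : 0 <= t -> M x <= N (x + iota t *: x0) - t * N x0.
  by move=> t0; apply: ge_inf; [exact: (S_inf x).2|exists t].
have le_M x y :
    (forall t, 0 <= t -> y <= N (x + iota t *: x0) - t * N x0) -> y <= M x.
  move=> yS; apply: lb_le_inf; first exact: (S_inf x).1.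
  by move=> _ [t t0 <-]; exact: yS.
have sM : sublinear M.
  split=> [x y|r x r0].
    rewrite -lerBlDr; apply: (le_M) => t t0.
    rewrite lerBlDr [leRHS]addrC -lerBlDr; apply: (le_M) => s s0.
    rewrite lerBlDr.
    have /le_trans := M_le (x + y) (t + s) (addr_ge0 t0 s0); apply.
    have := NA (x + iota t *: x0) (y + iota s *: x0).
    rewrite addrACA -scalerDl -iotaD; lra.
  apply/eqP; rewrite eq_le; apply/andP; split.
    rewrite mulrC -ler_pdivrMr//; apply: (le_M) => t t0.
    rewrite ler_pdivrMr// mulrBl.
    have /le_trans := M_le (iota r *: x) (r * t) (mulr_ge0 (ltW r0) t0); apply.
    rewrite iotaM -scalerA -scalerDr NZ//; lra.
  apply: (le_M) => t t0; rewrite -[t](mulVKf (lt0r_neq0 r0)).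
  rewrite iotaM -scalerA -scalerDr NZ// -mulrA -mulrBr ler_pM2l//.
  by apply: M_le; rewrite mulr_ge0// invr_ge0 ltW.
have MN : M = N.
  apply: Nmin => // x.
  by have := M_le x 0 (lexx 0); rewrite iota0 scale0r addr0 mul0r subr0.
have := sublinear_ge x0 sN.
have := M_le (- x0) 1 ler01; rewrite iota1 scale1r addNr N0 mul1r MN; lra.
Qed.

(** Zorn's lemma provides a minimal sublinear functional below [N]; being odd, it is additive, since
    subadditivity at [- x] and [- y] reverses the inequality. *)
Theorem hahn_banach_sublinear N : sublinear N ->
  exists g : E -> R, [/\ forall x y, g (x + y) = g x + g y,
    forall r x, g (iota r *: x) = r * g x & forall x, g x <= N x].
Proof.
move=> sN.
pose T := {M : E -> R | sublinear M /\ forall x, M x <= N x}.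
(* The order is reversed: a maximal element is a minimal functional, and a chain is bounded by its
   pointwise infimum. *)
pose leT (M L : T) := `[< forall x, sval L x <= sval M x >].
have [|||A totA|M Mmax] := @Zorn T leT.
- by move=> M; apply/asboolP => x.
- move=> M L P /asboolP ML /asboolP LP; apply/asboolP => x.
  exact: le_trans (LP x) (ML x).
- move=> [M hM] [L hL] /asboolP/= ML /asboolP/= LM.
  by apply: eq_exist; apply/funext => x; apply/eqP; rewrite eq_le ML LM.
- have [[M0 AM0]|A0] := pselect (exists M, A M); last first.
    exists (exist _ N (conj sN (fun x => lexx (N x)))) => M AM.
    by case: A0; exists M.
  pose S x := [set sval M x | M in A].
  have S_lb x : lbound (S x) (- N (- x)).
    move=> _ [[M [sM MN]] AM <-] /=.
    by have := sublinear_ge x sM; have := MN (- x); lra.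
  have S_inf x : has_inf (S x) by split; [exists (sval M0 x), M0|exists (- N (- x))].
  pose L x := inf (S x).
  have L_le x M : A M -> L x <= sval M x.
    by move=> AM; apply: ge_inf; [exact: (S_inf x).2|exists M].
  have le_L x y : (forall M, A M -> y <= sval M x) -> y <= L x.
    move=> yS; apply: lb_le_inf; first exact: (S_inf x).1.
    by move=> _ [M AM <-]; exact: yS.
  have sL : sublinear L.
    split=> [x y|r x r0].
      rewrite -lerBlDr; apply: (le_L) => M AM.
      rewrite lerBlDr [leRHS]addrC -lerBlDr; apply: (le_L) => P AP.
      rewrite lerBlDr [leRHS]addrC.
      (* The values of [M] and [P] dominate those of the smaller of the two, whose subadditivity
         concludes. *)
      have [MP|PM] := totA _ _ AM AP.
        have /le_trans := L_le (x + y) _ AP; apply.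
        have := (svalP P).1.1 x y; have := asboolW MP x; lra.
      have /le_trans := L_le (x + y) _ AM; apply.
      have := (svalP M).1.1 x y; have := asboolW PM y; lra.
    apply/eqP; rewrite eq_le; apply/andP; split.
      rewrite mulrC -ler_pdivrMr//; apply: (le_L) => M AM.
      by rewrite ler_pdivrMr// mulrC -(svalP M).1.2//; exact: L_le.
    apply: (le_L) => M AM; rewrite (svalP M).1.2//.
    by rewrite ler_pM2l//; exact: L_le.
  have LN x : L x <= N x by apply: le_trans (L_le x _ AM0) _; exact: (svalP M0).2.
  by exists (exist _ L (conj sL LN)) => M AM; apply/asboolP => x; exact: L_le.
have [sM MN] := svalP M; exists (sval M).
have odd : forall x, sval M (- x) = - sval M x.
  apply: minimal_sublinear_odd => // L sL LM.
  have LN x : L x <= N x by apply: le_trans (LM x) _.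
  by have /(congr1 sval) := Mmax (exist _ L (conj sL LN)) ltac:(exact/asboolP).
split=> //.
  move=> x y; apply/eqP; rewrite eq_le sM.1/=.
  by have := sM.1 (- x) (- y); rewrite -opprD !odd; lra.
move=> r x; have [r0|r0|->] := ltgtP r 0; last 2 first.
- exact: sM.2.
- by rewrite iota0 scale0r sublinear0// mul0r.
rewrite -[r]opprK iotaN scaleNr odd sM.2 ?oppr_gt0//; lra.
Qed.

End HahnBanach.

(** * Real and complex scalars, and the sandwich theorem *)

(** A common interface to the two scalar fields: [iota] embeds the reals and [re] is the real part,
    so that one Hahn-Banach argument serves both. [complexify] recovers a [K]-linear functional from
    its real part. *)
Record real_structure (K : numFieldType) (R : realType)
    (iota : R -> K) (re : K -> R) := RealStructure {
  iotaB : {morph iota : x y / x - y};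
  iotaM : {morph iota : x y / x * y};
  iota1 : iota 1 = 1;
  ler_iota : forall r s, (iota r <= iota s) = (r <= s);
  reD : {morph re : x y / x + y};
  re_iotaM : forall r z, re (iota r * z) = r * re z;
  ler_re : {homo re : x y / x <= y};
  re_le_norm : forall z, re z <= re `|z|;
  ge0_iota_re : forall z, 0 <= z -> iota (re z) = z;
  complexify : forall (E : lmodType K) (g : E -> R),
    {morph g : x y / x + y} -> (forall r x, g (iota r *: x) = r * g x) ->
    exists2 G : E -> K, linear (G : E -> K^o) & forall x, re (G x) = g x }.

Lemma real_real_structure (R : realType) :
  @real_structure R R id id.
Proof.
split=> //; first exact: ler_norm.
move=> E g gD gZ; exists g => //.
by move=> a x y; rewrite gD gZ.
Qed.

Lemma complex_real_structure (R : realType) :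
  @real_structure R[i] R (real_complex R) (@complex.Re R).
Proof.
split.
- exact: rmorphB.
- exact: rmorphM.
- exact: rmorph1.
- exact: lecR.
- by case=> a b [c d].
- by move=> r [a b]; rewrite /= mul0r subr0.
- by move=> x y; rewrite lecE => /andP[].
- move=> z; rewrite normc_def /=.
  have [z0|z0] := leP (complex.Re z) 0; first exact: le_trans (sqrtr_ge0 _).
  have /ler_wsqrtr : complex.Re z ^+ 2 <= complex.Re z ^+ 2 + complex.Im z ^+ 2.
    by rewrite lerDl sqr_ge0.
  by rewrite sqrtr_sqr gtr0_norm.
- by move=> z z0; rewrite RRe_real// ger0_real.
move=> E g gD gZ.
have gN x : g (- x) = - g x.
  by rewrite -scaleN1r -(rmorph1 (real_complex R)) -rmorphN gZ mulN1r.
(* The complex-linear functional with real part [g] is [g x - i g (i x)]. *)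
exists (fun x => Complex (g x) (- g ('i%C *: x))) => // -[a b] x y.
have abE : Complex a b = a%:C%C + b%:C%C * 'i%C by simpc.
have sE z : Complex a b *: z = a%:C%C *: z + b%:C%C *: ('i%C *: z).
  by rewrite abE scalerDl scalerA.
have iZ (r : R) (z : E) : 'i%C *: (r%:C%C *: z) = r%:C%C *: ('i%C *: z).
  by rewrite !scalerA mulrC.
have ii (z : E) : 'i%C *: ('i%C *: z) = - z.
  by rewrite scalerA -expr2 sqr_i scaleN1r.
rewrite sE !scalerDr !iZ ii !gD !gZ gN [_ *: _]/GRing.scale/=.
by apply/eqP; rewrite eq_complex/=; apply/andP; split; apply/eqP; lra.
Qed.

Lemma real_structure_exists (K : numFieldType) : real_or_complex K ->
  exists (R : realType) (iota : R -> K) (re : K -> R), real_structure iota re.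
Proof.
case=> R [->|->]; first by exists R, id, id; exact: real_real_structure.
by exists R, (real_complex R), (@complex.Re R); exact: complex_real_structure.
Qed.

Definition seminorm (K : numFieldType) (E : lmodType K) (p : E -> K) :=
  [/\ forall x, 0 <= p x, forall x y, p (x + y) <= p x + p y &
      forall a x, p (a *: x) = `|a| * p x].

Section Scalars.
Context {K : numFieldType} (K_scalars : real_or_complex K).

(** Nonnegative elements of [K] are real, so the supremum can be taken in [R] and embedded back. An
    upper bound [b] is real too, as it dominates a nonnegative element. *)
Lemma lub_exists (A : set K) (M : K) : A !=set0 -> (forall a, A a -> 0 <= a <= M) ->
  exists s, [/\ 0 <= s, forall a, A a -> a <= s &
    forall b, (forall a, A a -> a <= b) -> s <= b].
Proof.
have [R [iota [re S]]] := real_structure_exists K_scalars.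
move=> [a0 Aa0] AM.
have A_ge0 a : A a -> 0 <= a by move=> /AM /andP[].
have supA : has_sup (re @` A).
  split; first by exists (re a0), a0.
  by exists (re M) => _ [a /AM /andP[_ aM] <-]; exact/(ler_re S).
have ub a : A a -> a <= iota (sup (re @` A)).
  move=> Aa; rewrite -[leLHS](ge0_iota_re S) ?A_ge0// (ler_iota S).
  by apply: ub_le_sup; [exact: supA.2|exists a].
exists (iota (sup (re @` A))); split=> //.
  exact: le_trans (A_ge0 _ Aa0) (ub _ Aa0).
move=> b Ab; have b0 : 0 <= b by exact: le_trans (A_ge0 _ Aa0) (Ab _ Aa0).
rewrite -[leRHS](ge0_iota_re S)// (ler_iota S); apply: ge_sup; first exact: supA.1.
by move=> _ [a Aa <-]; apply: (ler_re S); exact: Ab.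
Qed.

Lemma glb_exists (A : set K) : A !=set0 -> (forall a, A a -> 0 <= a) ->
  exists s, [/\ 0 <= s, forall a, A a -> s <= a &
    forall b, 0 <= b -> (forall a, A a -> b <= a) -> b <= s].
Proof.
move=> [a0 Aa0] A_ge0.
have [||s [s0 sub slub]] := @lub_exists
    [set b | 0 <= b /\ forall a, A a -> b <= a] a0.
- by exists 0.
- by move=> b [b0 Ab]; rewrite b0 Ab.
exists s; split=> // [a Aa|b b0 Ab]; last exact: sub.
by apply: slub => b [_]; apply.
Qed.

(* With the infimal convolution N x = inf_y Re (phi y) + q y + p (x - v y), a
   real-linear g <= N satisfies g <= p and |g (v y) - Re (phi y)| <= q y. *)
Lemma hahn_banach_sandwich (E F : lmodType K) (v : F -> E) (phi : F -> K)
    (q : F -> K) (p : E -> K) :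
  linear v -> linear (phi : F -> K^o) -> seminorm q -> seminorm p ->
  (forall y, `|phi y| <= q y + p (v y)) ->
  exists2 g : E -> K, linear (g : E -> K^o) &
    (forall x, `|g x| <= p x) /\ (forall y, `|g (v y) - phi y| <= q y).
Proof.
have [R [iota [re S]]] := real_structure_exists K_scalars.
move=> lv lphi [q0 qD qZ] [p0 pD pZ] phi_le.
have vD x y : v (x + y) = v x + v y by have := lv 1 x y; rewrite !scale1r.
have phiD x y : phi (x + y) = phi x + phi y.
  by have := lphi 1 x y; rewrite !scale1r.
have v0 : v 0 = 0 by apply: (addrI (v 0)); rewrite -vD !addr0.
have phi0 : phi 0 = 0 by apply: (addrI (phi 0)); rewrite -phiD !addr0.
have vZ a x : v (a *: x) = a *: v x by rewrite -[a *: x]addr0 lv v0 addr0.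
have phiZ a x : phi (a *: x) = a * phi x by rewrite -[a *: x]addr0 lphi phi0 addr0.
have iota0 : iota 0 = 0 by rewrite -(subrr 0) (iotaB S) subrr.
have re0 : re 0 = 0 by apply: (addrI (re 0)); rewrite -(reD S) !addr0.
have reN z : re (- z) = - re z.
  by apply: (addrI (re z)); rewrite -(reD S) !subrr.
have norm_iota r : 0 <= r -> `|iota r| = iota r.
  by move=> r0; rewrite ger0_norm// -iota0 (ler_iota S).
pose Q y := re (q y); pose P x := re (p x).
have QD x y : Q (x + y) <= Q x + Q y by rewrite -(reD S); exact/(ler_re S)/qD.
have PD x y : P (x + y) <= P x + P y by rewrite -(reD S); exact/(ler_re S)/pD.
have QZ r y : 0 <= r -> Q (iota r *: y) = r * Q y.
  by move=> r0; rewrite /Q qZ norm_iota// (re_iotaM S).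
have PZ r y : 0 <= r -> P (iota r *: y) = r * P y.
  by move=> r0; rewrite /P pZ norm_iota// (re_iotaM S).
have PN x : P (- x) = P x by rewrite /P -scaleN1r pZ normrN normr1 mul1r.
have QN x : Q (- x) = Q x by rewrite /Q -scaleN1r qZ normrN normr1 mul1r.
have Q0 : Q 0 = 0 by have := QZ 0 0 (lexx 0); rewrite scaler0 mul0r.
have P0 : P 0 = 0 by have := PZ 0 0 (lexx 0); rewrite scaler0 mul0r.
have phi_leR y : re (phi y) <= Q y + P (v y).
  apply: (le_trans (re_le_norm S _)); rewrite /Q /P -(reD S).
  exact/(ler_re S)/phi_le.
pose T x := [set re (phi y) + Q y + P (x - v y) | y in setT].
(* The hypothesis on [phi] makes the infimum finite: at [- y] it bounds [- Re (phi y)] by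
   [q y + p (v y)], and [p (v y) <= p (x - v y) + p x]. *)
have T_lb x : lbound (T x) (- P x).
  move=> _ [y _ <-]; have := phi_leR (- y).
  rewrite -scaleN1r phiZ vZ !scaleN1r mulN1r reN QN PN.
  have := PD (v y - x) x; rewrite subrK -[v y - x]opprB PN; lra.
have T_inf x : has_inf (T x).
  by split; [exists (re (phi 0) + Q 0 + P (x - v 0)), 0|exists (- P x)].
pose N x := inf (T x).
have N_le x y : N x <= re (phi y) + Q y + P (x - v y).
  by apply: ge_inf; [exact: (T_inf x).2|exists y].
have le_N x b : (forall y, b <= re (phi y) + Q y + P (x - v y)) -> b <= N x.
  move=> bT; apply: lb_le_inf; first exact: (T_inf x).1.
  by move=> _ [y _ <-]; exact: bT.
have sN : @sublinear R K iota E N.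
  split=> [x y|r x r0].
    rewrite -lerBlDr; apply: (le_N) => s.
    rewrite lerBlDr [leRHS]addrC -lerBlDr; apply: (le_N) => t.
    rewrite lerBlDr; apply: le_trans (N_le (x + y) (s + t)) _.
    have := QD s t; have := PD (x - v s) (y - v t).
    rewrite phiD vD (reD S) addrACA -opprD; lra.
  have rK y : y = iota r *: (iota r^-1 *: y).
    by rewrite scalerA -(iotaM S) divff ?gt_eqF// (iota1 S) scale1r.
  have N_r y : re (phi (iota r *: y)) + Q (iota r *: y) +
      P (iota r *: x - v (iota r *: y)) = r * (re (phi y) + Q y + P (x - v y)).
    by rewrite phiZ vZ -scalerBr PZ ?QZ ?ltW// (re_iotaM S) !mulrDr.
  apply/eqP; rewrite eq_le; apply/andP; split.
    rewrite mulrC -ler_pdivrMr//; apply: (le_N) => y.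
    by rewrite ler_pdivrMr// mulrC -N_r; exact: N_le.
  apply: (le_N) => y; rewrite [y]rK N_r ler_pM2l//; exact: N_le.
have [g [gD gZ gN]] := hahn_banach_sublinear (iotaB S) (iotaM S) (iota1 S) sN.
have [G lG Gg] := complexify S gD gZ.
have GD x y : G (x + y) = G x + G y by have := lG 1 x y; rewrite !scale1r.
have G0 : G 0 = 0 by apply: (addrI (G 0)); rewrite -GD !addr0.
have GZ a x : G (a *: x) = a * G x by rewrite -[a *: x]addr0 lG G0 addr0.
(* A unimodular [c] makes the value at [c *: x] equal to the modulus of the value at [x]; as [p] and
   [q] ignore such factors, the one-sided bounds on [g] become bounds on moduli. *)
have rotate z : exists2 c : K, `|c| = 1 & `|z| = c * z.
  have [->|z0] := eqVneq z 0; first by exists 1; rewrite ?normr1// normr0 mulr0.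
  exists (`|z| / z); last by rewrite divfK.
  by rewrite normf_div normr_id divff// normr_eq0.
exists G => //; split=> [x|y].
  have [c c1 cG] := rotate (G x).
  rewrite -[leLHS](ge0_iota_re S)// -[leRHS](ge0_iota_re S)// (ler_iota S).
  rewrite cG -GZ Gg; apply: le_trans (gN _) _.
  have := N_le (c *: x) 0; rewrite phi0 re0 Q0 v0 subr0 !add0r /P pZ c1 mul1r.
  by [].
have [c c1 cG] := rotate (G (v y) - phi y).
rewrite -[leLHS](ge0_iota_re S)// -[leRHS](ge0_iota_re S)// (ler_iota S).
rewrite cG mulrBr -GZ -phiZ (reD S) reN Gg -vZ lerBlDl.
apply: le_trans (gN _) _.
by have := N_le (v (c *: y)) (c *: y); rewrite subrr P0 addr0 /Q qZ c1 mul1r.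
Qed.

End Scalars.

(** * Banach discs and the space normed by their gauge *)

Section BanachDisc.
Context {K : numFieldType} {E : completeNormedModType K}.

(** Boundedness makes the gauge a norm that dominates a multiple of the norm of [E]; closedness then
    transfers completeness from [E] to the span. *)
Record banach_disc := BanachDisc {
  disc_set :> E -> Prop;
  disc0 : disc_set 0;
  disc_absconvex : forall a b x y, `|a| + `|b| <= 1 ->
    disc_set x -> disc_set y -> disc_set (a *: x + b *: y);
  disc_closed : forall x,
    (forall e, 0 < e -> exists2 y, disc_set y & `|x - y| <= e) -> disc_set x;
  disc_bounded : exists M, forall x, disc_set x -> `|x| <= M }.

Lemma disc_scale (U : banach_disc) (a : K) (x : E) : `|a| <= 1 -> U x -> U (a *: x).
Proof.
move=> a1 Ux; have := @disc_absconvex U a 0 x 0.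
by rewrite normr0 addr0 scaler0 addr0; apply=> //; exact: disc0.
Qed.

(** The two points receive the weights [a l / (|a| l + m)] and [m / (|a| l + m)], whose moduli sum
    to one. This serves both the stability of the span and the triangle inequality of the gauge. *)
Lemma disc_combine (U : banach_disc) (a l m : K) (x y : E) : 0 < l -> 0 < m ->
  U (l^-1 *: x) -> U (m^-1 *: y) -> U ((`|a| * l + m)^-1 *: (a *: x + y)).
Proof.
move=> l0 m0.
have {2}-> : x = l *: (l^-1 *: x) by rewrite scalerKV// gt_eqF.
have {2}-> : y = m *: (m^-1 *: y) by rewrite scalerKV// gt_eqF.
move: (l^-1 *: x) (m^-1 *: y) => {}x {}y Ux Uy.
have L0 : 0 < `|a| * l + m by rewrite ltr_wpDl// mulr_ge0// ltW.
rewrite scalerDr !scalerA; apply: disc_absconvex => //.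
rewrite !normrM normfV !(gtr0_norm L0, gtr0_norm l0, gtr0_norm m0).
by rewrite -mulrDr mulVf// gt_eqF.
Qed.

Definition disc_span (U : banach_disc) : {pred E} :=
  fun x => `[< exists2 l : K, 0 < l & U (l^-1 *: x) >].

Fact disc_span_submod_closed (U : banach_disc) : submod_closed (disc_span U).
Proof.
split=> [|a x y /asboolP[l l0 Ux] /asboolP[m m0 Uy]]; apply/asboolP.
  by exists 1 => //; rewrite scaler0; exact: disc0.
exists (`|a| * l + m); last exact: disc_combine.
by rewrite ltr_wpDl// mulr_ge0// ltW.
Qed.

HB.instance Definition _ (U : banach_disc) :=
  GRing.isSubmodClosed.Build K E (disc_span U) (disc_span_submod_closed U).

(** The hypothesis on the scalars is a parameter of the type because the norm attached to it is a
    greatest lower bound, which is obtained from that hypothesis. *)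
Record disc_space (K_scalars : real_or_complex K) (U : banach_disc) :=
  DiscSpace { disc_val : E ; disc_valP : disc_val \in disc_span U }.

Section DiscSpace.
Variables (K_scalars : real_or_complex K) (U : banach_disc).
Local Notation H := (disc_space K_scalars U).

HB.instance Definition _ := [isSub of H for @disc_val K_scalars U].
HB.instance Definition _ := [Choice of H by <:].
HB.instance Definition _ := [SubChoice_isSubLmodule of H by <:].

Fact gauge_subproof (x : H) : exists s, [/\ 0 <= s,
  forall a, [set l : K | 0 < l /\ U (l^-1 *: disc_val x)] a -> s <= a &
  forall b, 0 <= b ->
    (forall a, [set l : K | 0 < l /\ U (l^-1 *: disc_val x)] a -> b <= a) -> b <= s].
Proof.
apply: glb_exists => // [|a [/ltW]//].
by have /asboolP[l l0 Ux] := disc_valP x; exists l.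
Qed.

Definition gauge (x : H) : K := sval (cid (gauge_subproof x)).

Lemma gauge_ge0 x : 0 <= gauge x.
Proof. by rewrite /gauge; case: cid => s []. Qed.

Lemma gauge_le x l : 0 < l -> U (l^-1 *: disc_val x) -> gauge x <= l.
Proof. by rewrite /gauge; case: cid => s /= [_ + _] l0 Ux; apply. Qed.

(** The infimum need not be attained, hence the [e]: some admissible [l] lies below [gauge x + e],
    and shrinking a point of [U] keeps it in [U]. *)
Lemma gauge_lt x e : 0 < e -> U ((gauge x + e)^-1 *: disc_val x).
Proof.
move=> e0; have g0 := gauge_ge0 x.
have ge0 : 0 < gauge x + e by rewrite ltr_wpDl.
have [//|nU] := pselect (U ((gauge x + e)^-1 *: disc_val x)).
suff : gauge x + e <= gauge x by rewrite gerDl lt_geF.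
rewrite {2}/gauge; case: cid => s /= [_ _]; apply; first exact: ltW.
move=> l [l0 Ul]; rewrite real_leNgt ?gtr0_real//; apply/negP => lg.
apply: nU; rewrite -[disc_val x](scalerKV (lt0r_neq0 l0)) scalerA.
apply: disc_scale => //.
by rewrite gtr0_norm ?mulr_gt0 ?invr_gt0// mulrC ler_pdivrMr// mul1r ltW.
Qed.

Lemma ler_gaugeD x y : gauge (x + y) <= gauge x + gauge y.
Proof.
apply/ler_addgt0Pr => e e0.
have e20 : 0 < e / 2 by rewrite divr_gt0.
have gx : 0 < gauge x + e / 2 by rewrite ltr_wpDl// gauge_ge0.
have gy : 0 < gauge y + e / 2 by rewrite ltr_wpDl// gauge_ge0.
have -> : gauge x + gauge y + e = `|1| * (gauge x + e / 2) + (gauge y + e / 2).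
  by rewrite normr1 mul1r addrACA -splitr.
apply: gauge_le; first by rewrite normr1 mul1r addr_gt0.
rewrite -[disc_val (x + y)]/(disc_val x + disc_val y) -[disc_val x]scale1r.
by apply: disc_combine => //; exact: gauge_lt.
Qed.

Lemma gauge0 : gauge 0 = 0.
Proof.
apply/eqP; rewrite eq_le gauge_ge0 andbT; apply/ler_addgt0Pr => e e0.
by rewrite add0r; apply: gauge_le => //; rewrite scaler0; exact: disc0.
Qed.

Lemma ler_gaugeZ a x : gauge (a *: x) <= `|a| * gauge x.
Proof.
have [->|a0] := eqVneq a 0; first by rewrite scale0r gauge0 normr0 mul0r.
have na0 : 0 < `|a| by rewrite normr_gt0.
apply/ler_addgt0Pr => e e0.
have e'0 : 0 < e / `|a| by rewrite divr_gt0.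
have -> : `|a| * gauge x + e = `|a| * (gauge x + e / `|a|).
  by rewrite mulrDr mulrCA divff ?mulr1// gt_eqF.
have g0 : 0 < gauge x + e / `|a| by rewrite ltr_wpDl// gauge_ge0.
apply: gauge_le; first exact: mulr_gt0.
rewrite -[disc_val (a *: x)]/(a *: disc_val x) scalerA invfM mulrAC -scalerA.
apply: disc_scale; last exact: gauge_lt.
by rewrite normrM normfV normr_id mulVf// gt_eqF.
Qed.

Lemma gaugeZ a x : gauge (a *: x) = `|a| * gauge x.
Proof.
have [->|a0] := eqVneq a 0; first by rewrite scale0r gauge0 normr0 mul0r.
apply/eqP; rewrite eq_le ler_gaugeZ/=.
have := ler_gaugeZ a^-1 (a *: x); rewrite scalerA mulVf// scale1r normfV.
by rewrite mulrC ler_pdivlMr ?normr_gt0// mulrC.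
Qed.

Lemma disc_val_le :
  exists2 M : K, 0 <= M & forall x : H, `|disc_val x| <= M * gauge x.
Proof.
have [M UM] := disc_bounded U.
have M0 : 0 <= M by have := UM _ (disc0 U); rewrite normr0.
exists M => // x; apply/ler_addgt0Pr => e e0.
have M1 : 0 < M + 1 by rewrite ltr_wpDl.
have e'0 : 0 < e / (M + 1) by rewrite divr_gt0.
have g0 : 0 < gauge x + e / (M + 1) by rewrite ltr_wpDl// gauge_ge0.
have := UM _ (gauge_lt x e'0); rewrite normrZ normfV (gtr0_norm g0).
rewrite mulrC ler_pdivrMr// => /le_trans; apply; rewrite mulrDr lerD2l.
by rewrite mulrCA ger_pMr// ler_pdivrMr// mul1r lerDl.
Qed.

Lemma gauge_eq0 x : gauge x = 0 -> x = 0.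
Proof.
have [M _ xM] := disc_val_le => gx.
by apply/val_inj/eqP; rewrite -normr_le0 (le_trans (xM x))// gx mulr0.
Qed.

HB.instance Definition _ :=
  Lmodule_isNormed.Build K H ler_gaugeD gaugeZ gauge_eq0.

Lemma disc_space_norm_le (x : H) l : 0 < l -> U (l^-1 *: disc_val x) -> `|x| <= l.
Proof. exact: gauge_le. Qed.

(** The points [(1 + d)^-1 x] lie in [U] whether or not the infimum is attained, and they approach
    [x] in [E], so closedness applies. *)
Lemma disc_space_unit_ball (x : H) : `|x| <= 1 -> U (disc_val x).
Proof.
move=> x1; apply: disc_closed => e e0.
have x0 : 0 < `|disc_val x| + 1 by rewrite ltr_wpDl.
pose d := e / (`|disc_val x| + 1).
have d0 : 0 < d by rewrite divr_gt0.
have d1 : 0 < 1 + d by rewrite addr_gt0.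
have gd : 0 < gauge x + d by rewrite ltr_wpDl// gauge_ge0.
exists ((1 + d)^-1 *: disc_val x).
  rewrite -[disc_val x](scalerKV (lt0r_neq0 gd)) scalerA.
  apply: disc_scale; last exact: gauge_lt.
  rewrite gtr0_norm ?mulr_gt0 ?invr_gt0// mulrC ler_pdivrMr// mul1r lerD2r.
  exact: x1.
have -> : disc_val x - (1 + d)^-1 *: disc_val x = (d / (1 + d)) *: disc_val x.
  rewrite -[X in X - _]scale1r -scalerBl; congr (_ *: _).
  apply: (mulIf (lt0r_neq0 d1)).
  by rewrite mulrBl mul1r mulVf ?gt_eqF// divfK ?gt_eqF// addrC addKr.
have dd0 : 0 < d / (1 + d) by rewrite divr_gt0.
rewrite normrZ gtr0_norm//.
apply: (@le_trans _ _ (d * `|disc_val x|)).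
  by rewrite ler_wpM2r// ler_pdivrMr// ler_peMr ?lerDl// ltW.
by rewrite /d mulrAC ler_pdivrMr// ler_pM2l// lerDl.
Qed.

(** A Cauchy filter for the gauge converges in [E], the inclusion being bounded. Multiples of [U]
    are closed in [E], so the Cauchy estimates pass to the limit; this puts the limit in the span
    and gives convergence for the gauge. *)
Lemma disc_space_complete (F : set_system H) : ProperFilter F -> cauchy F -> cvg F.
Proof.
move=> FF /cauchy_ballP Fc.
have Fball e : 0 < e -> exists2 A, F A & forall x y, A x -> A y -> `|x - y| <= e.
  move=> e0; have [[A B] /= [FA FB] AB] := Fc e e0.
  exists (A `&` B); first exact: filterI.
  move=> x y [Ax _] [_ By]; have := AB (x, y) (conj Ax By) => /=.
  by rewrite -ball_normE /= => /ltW.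
have [M M0 valM] := disc_val_le.
have cE : cvg (@disc_val K_scalars U x @[x --> F]).
  apply: cauchy_cvg; apply/cauchy_ballP => e e0 /=.
  have M1 : 0 < M + 1 by rewrite ltr_wpDl.
  have [A FA AA] := Fball (e / (M + 1)) (divr_gt0 e0 M1).
  exists (@disc_val K_scalars U @` A, @disc_val K_scalars U @` A) => /=.
    have FA' : F (@disc_val K_scalars U @^-1` (@disc_val K_scalars U @` A)).
      by apply: filterS FA => z Az; exists z.
    by split; exact: FA'.
  move=> [_ _] /= [[x Ax <-] [y Ay <-]]; rewrite -ball_normE /=.
  rewrite -[_ - _]/(disc_val (x - y)).
  apply: (@le_lt_trans _ _ (M * (e / (M + 1)))).
    by apply: le_trans (valM _) _; rewrite ler_wpM2l//; exact: AA.
  by rewrite mulrCA gtr_pMr// ltr_pdivrMr// mul1r ltrDl.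
set x := lim (@disc_val K_scalars U x @[x --> F]) in cE.
have near_x A e : F A -> 0 < e -> exists2 b, A b & `|x - disc_val b| <= e.
  move=> FA e0; have /cvgrPdist_le /(_ e e0) Fe := cE.
  by have [b [Ab xb]] := filter_ex (filterI FA Fe); exists b.
have Ux A e a : 0 < e -> F A -> (forall x y, A x -> A y -> `|x - y| <= e) -> A a ->
    U (e^-1 *: (disc_val a - x)).
  move=> e0 FA Ae Aa; apply: disc_closed => d d0.
  have [b Ab xb] := near_x A (d * e) FA (mulr_gt0 d0 e0).
  exists (e^-1 *: disc_val (a - b)).
    rewrite -[_ *: disc_val _]/(disc_val (e^-1 *: (a - b))).
    apply: disc_space_unit_ball; rewrite normrZ normfV (gtr0_norm e0).
    by rewrite mulrC ler_pdivrMr// mul1r; exact: Ae.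
  rewrite -[disc_val (a - b)]/(disc_val a - disc_val b) -scalerBr opprB.
  rewrite addrC subrKA normrZ normfV (gtr0_norm e0) mulrC ler_pdivrMr//.
  by rewrite distrC.
have xU : x \in disc_span U.
  have [A FA AA] := Fball 1 ltr01.
  have [a Aa] := filter_ex FA.
  have ax : disc_val a - x \in disc_span U.
    by apply/asboolP; exists 1 => //; exact: (Ux A).
  by rewrite -[x](subKr (disc_val a)) rpredB//; exact: disc_valP.
apply/cvg_ex; exists (DiscSpace K_scalars xU); apply/cvgrPdist_le => e e0.
have [A FA AA] := Fball e e0.
apply: filterS (FA) => a Aa /=; rewrite distrC.
by apply: disc_space_norm_le => //; exact: (Ux A).
Qed.

HB.instance Definition _ := Uniform_isComplete.Build H disc_space_complete.

End DiscSpace.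
End BanachDisc.

(** * Completeness of products, the domains used for unions of [J]-bounded sets *)

Section ProdComplete.
Context {K : numFieldType} {E F : completeNormedModType K}.

HB.instance Definition _ := Pointed.on (E * F)%type.

Lemma prod_complete (G : set_system (E * F)%type) :
  ProperFilter G -> cauchy G -> cvg G.
Proof.
move=> GG /cauchy_ballP Gc.
have c1 : cvg (z.1 @[z --> G]).
  apply: cauchy_cvg; apply/cauchy_ballP => e e0.
  have [[A B] /= [GA GB] AB] := Gc e e0.
  exists (fst @` A, fst @` B) => /=.
    split; [apply: filterS GA|apply: filterS GB] => z Az; exists z => //.
  by move=> [_ _] /= [[x Ax <-] [y By <-]]; have [] := AB (x, y) (conj Ax By).
have c2 : cvg (z.2 @[z --> G]).
  apply: cauchy_cvg; apply/cauchy_ballP => e e0.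
  have [[A B] /= [GA GB] AB] := Gc e e0.
  exists (snd @` A, snd @` B) => /=.
    split; [apply: filterS GA|apply: filterS GB] => z Az; exists z => //.
  by move=> [_ _] /= [[x Ax <-] [y By <-]]; have [] := AB (x, y) (conj Ax By).
apply/cvg_ex; exists (lim (z.1 @[z --> G]), lim (z.2 @[z --> G])).
apply/cvg_ballP => e e0.
have /cvg_ballP/(_ e e0) b1 := c1; have /cvg_ballP/(_ e e0) b2 := c2.
by apply: filterS2 b1 b2 => z z1 z2; split.
Qed.

HB.instance Definition _ := Uniform_isComplete.Build (E * F)%type prod_complete.

End ProdComplete.

(** * Closure in a topology generated by seminorms *)

Section SeminormTopology.
Context {K : numFieldType} {V : lmodType K} (P : set (V -> K)).
Implicit Types (A : set V) (x : V).

Lemma closure_seminorm A x p e :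
  @closure (seminorm_topology P) A x -> P p -> p 0 = 0 -> 0 < e ->
  exists2 a, A a & p (a - x) < e.
Proof.
move=> clAx Pp p0 e0.
have : @nbhs _ (seminorm_topology P) x [set v | p (v - x) < e].
  rewrite nbhsE/=; exists [set v | p (v - x) < e]; last by [].
  split; last by rewrite /= subrr p0.
  exists [set [set v | p (v - x) < e]]; last by rewrite bigcup_set1.
  move=> _ ->; exists [fset [set v | p (v - x) < e]]%fset.
    by move=> B; rewrite inE => /eqP ->; apply/mem_set; exists p, x, e.
  by rewrite set_fset1 bigcap_set1.
by move=> /clAx[a [Aa xa]]; exists a.
Qed.

Hypothesis P_neq0 : P !=set0.
Hypothesis P_triangle : forall p, P p -> forall x y, p (x + y) <= p x + p y.
Hypothesis P_directed : forall p q, P p -> P q ->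
  exists2 r, P r & forall x, p x <= r x /\ q x <= r x.

(** Induction over the finitely many subbasic sets around [x]: directedness merges their seminorms
    into one, and the triangle inequality recentres at [x] a ball of radius [d] around [u], leaving
    the radius [d - q (x - u)]. *)
Lemma seminorm_nbhs (B : set V) x :
  @nbhs _ (seminorm_topology P) x B ->
  exists p e, [/\ P p, 0 < e & forall v, p (v - x) < e -> B v].
Proof.
rewrite nbhsE => -[W [[D' sD' <-] [i D'i ix]] sub].
have [s /= sS si] := sD' _ D'i.
suff [p [e [Pp e0 pe]]] : exists p e, [/\ P p, 0 < e &
    forall v, p (v - x) < e -> forall B', B' \in enum_fset s -> B' v].
  exists p, e; split=> // v /pe sv; apply: sub; exists i => //.
  rewrite -si; suff svs : (\bigcap_(B' in [set` s]) B') v by exact: svs.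
  by move=> B' /= /sv.
have : forall B', B' \in enum_fset s -> seminorm_subbase P B' /\ B' x.
  move=> B' B's; split; first by exact/set_mem/sS.
  move: ix; rewrite -si => ix; have ixs : (\bigcap_(C in [set` s]) C) x by exact: ix.
  exact: ixs.
elim: (enum_fset s) => [_|B0 t IH tP].
  by have [p Pp] := P_neq0; exists p, 1.
have [|p [e [Pp e0 pe]]] := IH.
  by move=> B' B't; apply: tP; rewrite inE B't orbT.
have [[q [u [d [Pq d0 B0E]]]] B0x] := tP B0 (mem_head _ _).
have {}B0x : q (x - u) < d by move: B0x; rewrite B0E.
have [r Pr pqr] := P_directed Pp Pq.
have [f f0 [fe fd]] : exists2 f, 0 < f & f <= e /\ f <= d - q (x - u).
  have d'0 : 0 < d - q (x - u) by rewrite subr_gt0.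
  have [ed|de] := real_leP (gtr0_real e0) (gtr0_real d'0); first by exists e.
  by exists (d - q (x - u)) => //; split=> //; exact: ltW.
exists r, f; split=> // v rv B'; rewrite inE => /predU1P[->|B't].
  rewrite B0E /=; have -> : v - u = (v - x) + (x - u) by rewrite subrKA.
  apply: le_lt_trans (P_triangle Pq _ _) _; rewrite -ltrBrDr.
  exact: le_lt_trans (pqr _).2 (lt_le_trans rv fd).
apply: pe B' B't; exact: le_lt_trans (pqr _).1 (lt_le_trans rv fe).
Qed.

Lemma seminorm_closure A x :
  (forall p e, P p -> 0 < e -> exists2 a, A a & p (a - x) < e) ->
  @closure (seminorm_topology P) A x.
Proof.
move=> Ax B /seminorm_nbhs[p [e [Pp e0 pB]]].
by have [a Aa ax] := Ax p e Pp e0; exists a; split=> //; exact: pB.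
Qed.

End SeminormTopology.

(** * Bounded operators and suprema over bounded sets *)

Section BoundedOperatorTheory.
Context {K : numFieldType}.
Implicit Types E F G : normedModType K.

Lemma bounded_operator_linear E F (u : 'L(E, F)) : linear u.
Proof. by have /asboolP[] := operator_funP u. Qed.

HB.instance Definition _ E F (u : 'L(E, F)) :=
  GRing.isLinear.Build K E F *:%R u (bounded_operator_linear u).

Lemma operator_bound E F (u : 'L(E, F)) :
  exists2 M : K, 0 < M & forall x, `|u x| <= M * `|x|.
Proof.
have /asboolP[_ [M uM]] := operator_funP u.
(* When [E] is trivial, [M] may be any element of [K], negative or not real. *)
exists (`|M| + 1); first by rewrite ltr_wpDl.
move=> x; rewrite mulrDl mul1r ler_wpDr//.
rewrite -[X in _ * X]normr_id -normrM ger0_norm ?uM//.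
exact: le_trans (uM x).
Qed.

Fact make_operator_subproof E F (f : E -> F) :
  linear f -> (exists M : K, forall x, `|f x| <= M * `|x|) ->
  f \in @bounded_operator_pred K E F.
Proof. by move=> lf fM; apply/asboolP. Qed.

Definition make_operator E F (f : E -> F) (lf : linear f)
    (fM : exists M : K, forall x, `|f x| <= M * `|x|) : 'L(E, F) :=
  BoundedOperator (make_operator_subproof lf fM).

Hypothesis K_scalars : real_or_complex K.

Section SupSeminorm.
Variables (E F : normedModType K) (A : set E).
Hypothesis bdA : exists M : K, forall x, A x -> `|x| <= M.

(** [supremum] is meaningful only where a least upper bound exists; the bounds on [A] and [u]
    provide one. For empty [A] the default value 0 satisfies the same three claims. *)
Lemma sup_seminorm_spec (u : 'L(E, F)) :
  [/\ 0 <= sup_seminorm A u, forall x, A x -> `|u x| <= sup_seminorm A u &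
    forall e, 0 <= e -> (forall x, A x -> `|u x| <= e) -> sup_seminorm A u <= e].
Proof.
rewrite /sup_seminorm; have [->|/set0P[a Aa]] := eqVneq A set0.
  by rewrite image_set0 supremum0; split.
have [M AM] := bdA; have [N N0 uN] := operator_bound u.
have [||s [s0 us sle]] := @lub_exists _ K_scalars [set `|u x| | x in A] (N * M).
- by exists `|u a|, a.
- move=> _ [x Ax <-]; rewrite normr_ge0/=.
  by apply: le_trans (uN x) _; rewrite ler_pM2l//; exact: AM.
have uS : supremums [set `|u x| | x in A] (supremum 0 [set `|u x| | x in A]).
  rewrite /supremum ifF; last by apply/negbTE/set0P; exists `|u a|, a.
  case: xgetP => // /(_ s); case; split; first exact: us.
  by move=> b ub; apply: sle.
have [ub lb] := uS; split.
- by apply: le_trans (ub _ _); last by exists a.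
- by move=> x Ax; apply: ub; exists x.
- by move=> e e0 ue; apply: lb => _ [x Ax <-]; exact: ue.
Qed.

Lemma sup_seminorm_ge0 u : 0 <= @sup_seminorm K E F A u.
Proof. by have [] := sup_seminorm_spec u. Qed.

Lemma le_sup_seminorm (u : 'L(E, F)) x : A x -> `|u x| <= sup_seminorm A u.
Proof. by have [_ + _] := sup_seminorm_spec u; apply. Qed.

Lemma sup_seminorm_le (u : 'L(E, F)) e : 0 <= e ->
  (forall x, A x -> `|u x| <= e) -> sup_seminorm A u <= e.
Proof. by have [_ _] := sup_seminorm_spec u; apply. Qed.

Lemma sup_seminorm_triangle (u v : 'L(E, F)) :
  sup_seminorm A (u + v) <= sup_seminorm A u + sup_seminorm A v.
Proof.
apply: sup_seminorm_le; first by rewrite addr_ge0// sup_seminorm_ge0.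
move=> x Ax; rewrite -[(u + v) x]/(u x + v x).
by apply: le_trans (ler_normD _ _) _; rewrite lerD// le_sup_seminorm.
Qed.

Lemma sup_seminorm0 : sup_seminorm A (0 : 'L(E, F)) = 0.
Proof.
apply/eqP; rewrite eq_le sup_seminorm_ge0 andbT; apply: sup_seminorm_le => // x _.
by rewrite -[(0 : 'L(E, F)) x]/(0 : F) normr0.
Qed.

End SupSeminorm.

Lemma sup_seminorm_subset E F (A B : set E) (u : 'L(E, F)) :
  (exists M : K, forall x, B x -> `|x| <= M) -> A `<=` B ->
  sup_seminorm A u <= sup_seminorm B u.
Proof.
move=> bdB AB; apply: sup_seminorm_le.
- by have [M BM] := bdB; exists M => x /AB/BM.
- exact: sup_seminorm_ge0.
- by move=> x /AB Bx; exact: le_sup_seminorm.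
Qed.

End BoundedOperatorTheory.

(** * [J]-bounded sets and the closures they define *)

Section BoundedSubsets.
Context {K : numFieldType}.
Local Notation banach := (completeNormedModType K).
Implicit Types (J : operator_ideal K) (E F : banach).

Lemma bounded_subsets_bounded J E A :
  bounded_subsets J E A -> exists2 M : K, 0 < M & forall x, A x -> `|x| <= M.
Proof.
move=> [F [u [_ Au]]]; have [M M0 uM] := operator_bound u.
exists M => // x /Au[y y1 <-]; apply: le_trans (uM y) _.
by rewrite ger_pMr.
Qed.

Lemma bounded_subsetsS J E A B :
  A `<=` B -> bounded_subsets J E B -> bounded_subsets J E A.
Proof. by move=> AB [F [u [Ju Bu]]]; exists F, u; split=> // x /AB/Bu. Qed.

Lemma bounded_subsets_image J E F (u : 'L(E, F)) A :
  bounded_subsets J E A -> bounded_subsets J F (u @` A).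
Proof.
move=> [G [v [Jv Av]]].
exists G, (comp_operator u (comp_operator v (id_operator G))).
split; first exact: ideal_comp.
by move=> _ [x /Av[y y1 <-] <-]; exists y.
Qed.

Fact fst_operator_subproof E F : linear (@fst E F) /\
  exists M : K, forall x : E * F, `|x.1| <= M * `|x|.
Proof.
split=> //; exists 1 => x; rewrite mul1r prod_normE.
by rewrite comparable_le_max ?lexx// real_comparable.
Qed.

Fact snd_operator_subproof E F : linear (@snd E F) /\
  exists M : K, forall x : E * F, `|x.2| <= M * `|x|.
Proof.
split=> //; exists 1 => x; rewrite mul1r prod_normE.
by rewrite comparable_le_max ?lexx ?orbT// real_comparable.
Qed.

Definition fst_operator E F : 'L((E * F)%type : banach, E) :=
  make_operator (fst_operator_subproof E F).1 (fst_operator_subproof E F).2.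

Definition snd_operator E F : 'L((E * F)%type : banach, F) :=
  make_operator (snd_operator_subproof E F).1 (snd_operator_subproof E F).2.

(** The operator [(y, z) |-> u y + v z] covers both sets, because the maximum norm puts [(y, 0)] and
    [(0, z)] in the unit ball. This is what makes the seminorms of [uniform_topology] directed. *)
Lemma bounded_subsetsU J E A B : bounded_subsets J E A ->
  bounded_subsets J E B -> bounded_subsets J E (A `|` B).
Proof.
move=> [F [u [Ju Au]]] [G [v [Jv Bv]]].
(* The factor 1 and the identities give [uv] the exact shape of [ideal_linear] and [ideal_comp]. *)
pose uv : 'L((F * G)%type : banach, E) :=
  1 *: comp_operator (id_operator E) (comp_operator u (fst_operator F G)) +
  comp_operator (id_operator E) (comp_operator v (snd_operator F G)).
have uvE y : uv y = u y.1 + v y.2.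
  rewrite -[uv y]/(1 *: u y.1 + v y.2); by rewrite scale1r.
exists (F * G)%type, uv; split.
  by apply: ideal_linear; exact: ideal_comp.
move=> x [/Au[y y1 <-]|/Bv[y y1 <-]]; [exists (y, 0)|exists (0, y)].
- rewrite /unit_ball/= prod_normE/= normr0.
  by rewrite comparable_ge_max ?real_comparable// y1 ler01.
- by rewrite uvE/= linear0 addr0.
- rewrite /unit_ball/= prod_normE/= normr0.
  by rewrite comparable_ge_max ?real_comparable// y1 ler01.
- by rewrite uvE/= linear0 add0r.
Qed.

Lemma bounded_subsets_set0 J E : bounded_subsets J E set0.
Proof.
exists E, 0; split; last by [].
apply: ideal_finite_rank; exists 0%N, (fun=> 0) => x; exists (fun=> 0).
by rewrite big_ord0.
Qed.

Lemma unit_ball_bound (E F : normedModType K) (u : 'L(E, F)) (e : K) :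
  (forall x, `|x| <= 1 -> `|u x| <= e) -> forall x, `|u x| <= e * `|x|.
Proof.
move=> ue x; have [->|x0] := eqVneq x 0; first by rewrite linear0 !normr0 mulr0.
have nx : 0 < `|x| by rewrite normr_gt0.
have := ue (`|x|^-1 *: x); rewrite linearZ !normrZ normfV normr_id.
by rewrite mulVf ?gt_eqF// => /(_ (lexx 1)); rewrite mulrC ler_pdivrMr.
Qed.

(** A neighbourhood of 0 contains a small closed ball, and the ball of radius 1 around [x] lies in
    [|x| + 1] times the unit ball; [J]-bounded sets are stable under these scalings. *)
Lemma bounded_classP J E F (T : 'L(E, F)) :
  bounded_class J E F T <-> bounded_subsets J F (T @` @unit_ball K E).
Proof.
split=> [/(_ 0)[V V0 JV]|JT x].
  have [e /= e0 eV] : exists2 e : K, 0 < e & forall y, `|y| < e -> V y.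
    move/nbhs_normP : V0 => [e /= e0 eV]; exists e => // y ye.
    by apply: eV; rewrite /= sub0r normrN.
  have e20 : 0 < e / 2 by rewrite divr_gt0.
  apply: bounded_subsetsS (bounded_subsets_image ((e / 2)^-1 *: id_operator F) JV).
  move=> _ [y y1 <-]; exists (T ((e / 2) *: y)).
    exists ((e / 2) *: y) => //; apply: eV; rewrite normrZ gtr0_norm//.
    apply: (@le_lt_trans _ _ (e / 2)); first by rewrite ger_pMr.
    by rewrite ltr_pdivrMr// ltr_pMr// ltr1n.
  rewrite linearZ -[LHS]/((e / 2)^-1 *: ((e / 2) *: T y)).
  by rewrite scalerK// gt_eqF.
have x1 : 0 < `|x| + 1 by rewrite ltr_wpDl.
exists (ball x 1); first exact: nbhsx_ballx.
apply: bounded_subsetsS (bounded_subsets_image ((`|x| + 1) *: id_operator F) JT).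
move=> _ [y xy <-]; exists (T ((`|x| + 1)^-1 *: y)).
  exists ((`|x| + 1)^-1 *: y) => //.
  rewrite /unit_ball/= normrZ normfV (gtr0_norm x1) mulrC ler_pdivrMr// mul1r -lerBlDl.
  apply: le_trans (lerB_dist _ _) _; rewrite distrC.
  by move: xy; rewrite -ball_normE /= => /ltW.
rewrite linearZ -[LHS]/((`|x| + 1) *: ((`|x| + 1)^-1 *: T y)).
by rewrite scalerKV// gt_eqF.
Qed.

Section Closures.
Hypothesis K_scalars : real_or_complex K.

Lemma uniform_closureP J E F (A : set 'L(E, F)) (T : 'L(E, F)) :
  operator_closure (uniform_topology J) E F A T <->
  forall B e, bounded_subsets J E B -> 0 < e ->
    exists2 S, A S & forall x, B x -> `|S x - T x| <= e.
Proof.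
have bd B : bounded_subsets J E B -> exists M : K, forall x, B x -> `|x| <= M.
  by move=> /bounded_subsets_bounded[M _ BM]; exists M.
split=> [clT B e JB e0|AT].
  have [||||S AS ST] := @closure_seminorm K 'L(E, F)
    [set @sup_seminorm K E F B | B in bounded_subsets J E] A T (sup_seminorm B) e.
  - exact: clT.
  - by exists B.
  - by rewrite sup_seminorm0//; exact: bd.
  - exact: e0.
  exists S => // x Bx.
  exact: le_trans (le_sup_seminorm K_scalars (bd _ JB) (S - T) Bx) (ltW ST).
apply: (@seminorm_closure K 'L(E, F)
    [set @sup_seminorm K E F B | B in bounded_subsets J E]).
- by exists (@sup_seminorm K E F set0), set0 => //; exact: bounded_subsets_set0.
- by move=> _ [B JB <-] u v; apply: sup_seminorm_triangle => //; exact: bd.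
- move=> _ _ [B JB <-] [C JC <-].
  have JBC := bounded_subsetsU JB JC.
  exists (sup_seminorm (B `|` C)); first by exists (B `|` C).
  by move=> u; split; apply: sup_seminorm_subset => //; exact: bd.
- move=> _ e [B JB <-] e0.
  have e20 : 0 < e / 2 by rewrite divr_gt0.
  have [S AS ST] := AT B (e / 2) JB e20; exists S => //.
  apply: (@le_lt_trans _ _ (e / 2)); last by rewrite ltr_pdivrMr// ltr_pMr// ltr1n.
  by apply: sup_seminorm_le => //; [exact: bd|exact: ltW].
Qed.

Lemma norm_closureP E F (A : set 'L(E, F)) (T : 'L(E, F)) :
  operator_closure norm_topology E F A T <->
  forall e, 0 < e -> exists2 S, A S & forall x, `|S x - T x| <= e * `|x|.
Proof.
have bd : exists M : K, forall x, @unit_ball K E x -> `|x| <= M by exists 1.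
split=> [clT e e0|AT].
  have [||||S AS ST] := @closure_seminorm K 'L(E, F) [set @operator_norm K E F]
    A T (@operator_norm K E F) e.
  - exact: clT.
  - by [].
  - exact: sup_seminorm0.
  - exact: e0.
  exists S => // x; apply: (@unit_ball_bound _ _ (S - T)) => y y1.
  exact: le_trans (le_sup_seminorm K_scalars bd (S - T) y1) (ltW ST).
apply: (@seminorm_closure K 'L(E, F) [set @operator_norm K E F]).
- by exists (@operator_norm K E F).
- by move=> _ -> u v; exact: sup_seminorm_triangle.
- by move=> _ _ -> ->; exists (@operator_norm K E F).
- move=> _ e -> e0; have e20 : 0 < e / 2 by rewrite divr_gt0.
  have [S AS ST] := AT (e / 2) e20; exists S => //.
  apply: (@le_lt_trans _ _ (e / 2)); last by rewrite ltr_pdivrMr// ltr_pMr// ltr1n.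
  apply: sup_seminorm_le => //; first exact: ltW.
  by move=> x x1; apply: le_trans (ST x) _; rewrite ger_pMr.
Qed.

End Closures.
End BoundedSubsets.

(** * Finite rank operators as sums of rank one operators *)

Section FiniteRank.
Context {K : numFieldType}.
Local Notation banach := (completeNormedModType K).
Implicit Types E F G : banach.

Lemma finite_rank_comp E F G (S : 'L(F, G)) (T : 'L(E, F)) :
  finite_rank F G S -> finite_rank E G (comp_operator S T).
Proof. by move=> [n [y Sy]]; exists n, y => x; exact: Sy. Qed.

Fact rank_one_subproof (E F : normedModType K) (g : 'L(E, K^o)) (z : F) :
  linear (fun x => (g x : K) *: z) /\
  exists M : K, forall x, `|(g x : K) *: z| <= M * `|x|.
Proof.
split=> [a x y|]; first by rewrite linearP scalerDl scalerA.
have [M M0 gM] := operator_bound g.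
by exists (M * `|z|) => x; rewrite normrZ mulrAC ler_wpM2r.
Qed.

Definition rank_one (E F : normedModType K) (g : 'L(E, K^o)) (z : F) : 'L(E, F) :=
  make_operator (rank_one_subproof g z).1 (rank_one_subproof g z).2.

Lemma finite_rankD_rank_one E F (S : 'L(E, F)) (g : 'L(E, K^o)) (z : F) :
  finite_rank E F S -> finite_rank E F (rank_one g z + S).
Proof.
move=> [n [y Sy]]; exists n.+1, (fun i => oapp y z (unlift ord0 i)) => x.
have [c Sc] := Sy x; exists (fun i => oapp c (g x) (unlift ord0 i)).
rewrite big_ord_recl unlift_none /=.
under eq_bigr do rewrite liftK /=.
by rewrite -Sc.
Qed.

Hypothesis K_scalars : real_or_complex K.

(** The sandwich theorem along the line of [z]: [q = 0] leaves no error there, so [g z = 1] exactly,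
    while [p x = |x| / |z|] makes [g] bounded. *)
Lemma dual_vector (E : normedModType K) (z : E) : z != 0 ->
  exists g : 'L(E, K^o), g z = 1.
Proof.
move=> z0; have nz : 0 < `|z| by rewrite normr_gt0.
have [||||y|g lg [gp gz]] := @hahn_banach_sandwich K K_scalars E K^o
  (fun c => (c : K) *: z) id (fun=> 0) (fun x => `|z|^-1 * `|x|).
- by move=> a x y; rewrite scalerDl scalerA.
- by [].
- by split=> // *; rewrite ?addr0 ?mulr0.
- split=> [x|x y|a x].
  + by rewrite mulr_ge0// invr_ge0.
  + by rewrite -mulrDr ler_pM2l ?invr_gt0// ler_normD.
  + by rewrite normrZ mulrCA.
- by rewrite add0r normrZ mulrCA mulVf ?mulr1// gt_eqF.
have gM : exists M : K, forall x, `|g x : K^o| <= M * `|x| by exists `|z|^-1.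
exists (make_operator (lg : linear (g : E -> K^o)) gM).
by apply/eqP; rewrite -subr_eq0 -normr_le0; have := gz 1; rewrite scale1r.
Qed.

(** [finite_rank] yields coefficients point by point, neither linear nor continuous in [x]. A
    bounded [g] with [g (y ord0) = 1] splits off the rank one operator [g (w x) *: y ord0]; the
    remainder takes its values in the span of the other [y i], each corrected by a multiple of
    [y ord0]. *)
Lemma finite_rank_decomposition E F (w : 'L(E, F)) : finite_rank E F w ->
  exists s : seq ('L(E, K^o) * F), forall x, w x = \sum_(i <- s) (i.1 x : K) *: i.2.
Proof.
move=> [n [y]]; elim: n y w => [|n IH] y w wy.
  by exists [::] => x; rewrite big_nil; have [c ->] := wy x; rewrite big_ord0.
have [y0|y0] := eqVneq (y ord0) 0.
  apply: (IH (fun i => y (lift ord0 i))) => x; have [c ->] := wy x.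
  by exists (fun i => c (lift ord0 i)); rewrite big_ord_recl y0 scaler0 add0r.
have [g gy0] := dual_vector y0.
have [|s ws] := IH (fun i => y (lift ord0 i) - (g (y (lift ord0 i)) : K) *: y ord0)
    (w - comp_operator (rank_one g (y ord0)) w).
  move=> x; have [c wc] := wy x; exists (fun i => c (lift ord0 i)).
  rewrite -[LHS]/(w x - (g (w x) : K) *: y ord0) wc big_ord_recl.
  have -> : (g (c ord0 *: y ord0 +
        \sum_(i < n) c (lift ord0 i) *: y (lift ord0 i)) : K) =
      c ord0 + \sum_(i < n) c (lift ord0 i) * (g (y (lift ord0 i)) : K).
    have gZ a u : (g (a *: u) : K) = a * (g u : K) by exact: linearZ_LR.
    have gD u v : (g (u + v) : K) = (g u : K) + (g v : K).
      by have := bounded_operator_linear g 1 u v; rewrite !scale1r.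
    rewrite gD gZ gy0 mulr1 linear_sum; congr (_ + _).
    by apply: eq_bigr => i _; exact: gZ.
  rewrite scalerDl opprD addrACA subrr add0r scaler_suml -sumrB.
  by apply: eq_bigr => i _; rewrite scalerBr scalerA.
exists ((comp_operator g w, y ord0) :: s) => x.
rewrite big_cons -ws /= -[X in _ = _ + X]/(w x - (g (w x) : K) *: y ord0).
by rewrite addrC subrK.
Qed.

End FiniteRank.

(** * The tapered disc and approximation of the identity on [v(B_F)] *)

Section ApproximateIdentity.
Context {K : numFieldType} (K_scalars : real_or_complex K).
Context {E F : completeNormedModType K} (v : 'L(F, E)).

(* The points whose distance to t^-1 v(B_F) is at most t, for every t > 0. *)
Definition tapered_set : set E := [set x | forall t s, 0 < t -> t < s ->
  exists2 y, `|y| <= 1 & `|x - t^-1 *: v y| <= s].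

Fact tapered_set0 : tapered_set 0.
Proof.
move=> t s t0 ts; exists 0; rewrite ?normr0// linear0 scaler0 subr0 normr0.
by rewrite ltW// (lt_trans t0).
Qed.

Fact tapered_set_absconvex a b x y : `|a| + `|b| <= 1 ->
  tapered_set x -> tapered_set y -> tapered_set (a *: x + b *: y).
Proof.
move=> ab1 Ux Uy t s t0 ts.
have s0 : 0 <= s by rewrite ltW// (lt_trans t0).
have [x' x'1 xx'] := Ux t s t0 ts; have [y' y'1 yy'] := Uy t s t0 ts.
exists (a *: x' + b *: y').
  apply: le_trans (ler_normD _ _) _; rewrite !normrZ; apply: le_trans ab1.
  by rewrite lerD// ler_piMr.
have -> : v (a *: x' + b *: y') = a *: v x' + b *: v y'.
  by rewrite linearD !linearZ_LR.
rewrite scalerDr !(scalerA t^-1) !(mulrC t^-1) -!scalerA.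
rewrite opprD addrACA -!scalerBr; apply: le_trans (ler_normD _ _) _.
rewrite !normrZ; apply: (@le_trans _ _ (`|a| * s + `|b| * s)).
  by rewrite lerD// ler_wpM2l.
by rewrite -mulrDl ler_piMl.
Qed.

(** Distances are tested for every [s > t] rather than at [t], so half of the slack [s - t] pays for
    moving from [x] to [y] and the other half is granted by [y]. *)
Fact tapered_set_closed x :
  (forall e, 0 < e -> exists2 y, tapered_set y & `|x - y| <= e) -> tapered_set x.
Proof.
move=> clx t s t0 ts; have d0 : 0 < (s - t) / 2 by rewrite divr_gt0// subr_gt0.
have [y Uy xy] := clx _ d0.
have [|z z1 yz] := Uy t (t + (s - t) / 2) t0; first by rewrite ltrDl.
exists z => //; rewrite -[x](subrK y) -addrA.
apply: le_trans (ler_normD _ _) _; apply: le_trans (lerD xy yz) _.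
by rewrite addrCA -splitr addrC subrK.
Qed.

Fact tapered_set_bounded : exists M : K, forall x, tapered_set x -> `|x| <= M.
Proof.
have [M M0 vM] := operator_bound v; exists (2 + M) => x Ux.
have [y y1 xy] := Ux 1 2 ltr01 ltac:(by rewrite ltr1n).
rewrite -[x](subrK (v y)); apply: le_trans (ler_normD _ _) _.
rewrite lerD//; first by move: xy; rewrite invr1 scale1r.
by apply: le_trans (vM y) _; rewrite ger_pMr.
Qed.

Definition tapered_disc : banach_disc := BanachDisc tapered_set0
  tapered_set_absconvex tapered_set_closed tapered_set_bounded.

(** With [t = e / 2] and [s = e] the set lies within [e B_E] of a multiple of [v(B_F)], which is
    [J]-bounded; the Grothendieck property asks for this at every [e]. *)
Lemma tapered_set_bounded_subsets (J : operator_ideal K) :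
  grothendieck_property J -> ideal_class J F E v -> bounded_subsets J E tapered_set.
Proof.
move=> GJ Jv; apply: GJ => [|e e0].
  have [M UM] := tapered_set_bounded; exists M; split.
    by rewrite ger0_real//; have := UM 0 tapered_set0; rewrite normr0.
  by move=> m Mm x Ux /=; apply: le_trans (UM x Ux) (ltW Mm).
have e20 : 0 < e / 2 by rewrite divr_gt0.
exists (((e / 2)^-1 *: id_operator E) @` (v @` @unit_ball K F)).
  by apply: bounded_subsets_image; exists F, v; split.
move=> x Ux; have [|y y1 xy] := Ux (e / 2) e e20.
  by rewrite ltr_pdivrMr// ltr_pMr// ltr1n.
exists ((e / 2)^-1 *: v y); first by exists (v y) => //; exists y.
exists (e^-1 *: (x - (e / 2)^-1 *: v y)).
  by rewrite /unit_ball/= normrZ normfV gtr0_norm// mulrC ler_pdivrMr// mul1r.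
by rewrite scalerKV ?gt_eqF// addrC subrK.
Qed.

(** Source of the gauge estimate, by two regimes. For [t <= e] the point lies in [t^-1 v(B_F)],
    since [e |y| <= l]; for [t > e] it is within [e] of the origin, since [|v y| <= e l]. *)
Lemma tapered_set_image (y : F) (e l : K) : 0 < e -> 0 < l ->
  e * `|y| + e^-1 * `|v y| <= l -> tapered_set (l^-1 *: v y).
Proof.
move=> e0 l0 yl t s t0 ts.
have [te|et] := real_leP (gtr0_real t0) (gtr0_real e0).
  exists ((t / l) *: y).
    rewrite normrZ gtr0_norm ?divr_gt0// mulrAC ler_pdivrMr// mul1r.
    apply: le_trans yl; rewrite ler_wpDr ?ler_wpM2r//.
    by rewrite mulr_ge0// invr_ge0 ltW.
  have -> : v ((t / l) *: y) = (t / l) *: v y by exact: linearZ_LR.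
  rewrite scalerA mulrA mulVf ?gt_eqF// mul1r subrr normr0.
  by rewrite ltW// (lt_trans t0).
exists 0; rewrite ?normr0// linear0 scaler0 subr0 normrZ normfV gtr0_norm//.
rewrite mulrC ler_pdivrMr//; apply: (@le_trans _ _ (e * l)).
  rewrite -ler_pdivrMl//; apply: le_trans yl.
  by rewrite ler_wpDl// mulr_ge0// ltW.
by rewrite ler_pM2r// ltW// (lt_trans et).
Qed.

Local Notation H := (disc_space K_scalars tapered_disc).

Lemma disc_val_bounded : exists M : K, forall x : H, `|disc_val x| <= M * `|x|.
Proof. by have [M _ HM] := @disc_val_le K E K_scalars tapered_disc; exists M. Qed.

Definition disc_operator : 'L(H : completeNormedModType K, E) :=
  make_operator (fun a x y => erefl : disc_val (a *: x + y : H) = _)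
    disc_val_bounded.

Fact disc_lift_subproof (y : F) : v y \in disc_span tapered_disc.
Proof.
have l0 : 0 < 1 * `|y| + 1^-1 * `|v y| + 1.
  by rewrite ltr_wpDl// addr_ge0// mulr_ge0// invr_ge0 ler01.
apply/asboolP; exists (1 * `|y| + 1^-1 * `|v y| + 1) => //.
by apply: (@tapered_set_image y 1); rewrite ?ltr01// lerDl ler01.
Qed.

Definition disc_lift (y : F) : H := DiscSpace K_scalars (disc_lift_subproof y).

Lemma disc_lift_linear : linear disc_lift.
Proof. by move=> a x y; apply/val_inj; exact: linearP. Qed.

Lemma disc_lift_norm (e : K) (y : F) : 0 < e ->
  `|disc_lift y| <= e * `|y| + e^-1 * `|v y|.
Proof.
move=> e0; apply/ler_addgt0Pr => d d0.
have l0 : 0 < e * `|y| + e^-1 * `|v y| + d.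
  by rewrite ltr_wpDl// addr_ge0// mulr_ge0// ?invr_ge0 ltW.
apply: disc_space_norm_le => //.
by apply: (@tapered_set_image y e) => //; rewrite lerDl ltW.
Qed.

(* The smallness of the gauge norm of v y when v y is small in E makes f o v
   nearly continuous for the norm of E, so that the sandwich theorem applies. *)
Lemma functional_lift (f : 'L(H : completeNormedModType K, K^o)) (e : K) : 0 < e ->
  exists g : 'L(E, K^o),
    forall y, `|(g (v y) : K) - (f (disc_lift y) : K)| <= e * `|y|.
Proof.
move=> e0; have [C C0 fC] := operator_bound f.
(* In the gauge estimate at [d], multiplied by [C], the term in [|y|] becomes [q y = e |y|] and the
   term in [|v y|] becomes [p (v y)]. *)
have [d Cd d0] : exists2 d, C * d = e & 0 < d.
  by exists (e / C); rewrite ?divr_gt0// mulrC divfK// gt_eqF.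
have [||||y|g lg [gp gf]] := @hahn_banach_sandwich K K_scalars E F v
  (fun y => f (disc_lift y)) (fun y => e * `|y|) (fun x => C * d^-1 * `|x|).
- exact: bounded_operator_linear.
- by move=> a x y; rewrite disc_lift_linear; exact: linearP.
- split=> [x|x y|a x].
  + by rewrite mulr_ge0// ltW.
  + by rewrite -mulrDr ler_pM2l// ler_normD.
  + by rewrite normrZ mulrCA.
- have Cd0 : 0 < C * d^-1 by rewrite mulr_gt0// invr_gt0.
  split=> [x|x y|a x].
  + by rewrite mulr_ge0// ltW.
  + by rewrite -mulrDr ler_pM2l// ler_normD.
  + by rewrite normrZ mulrCA.
- apply: le_trans (fC _) _.
  have -> : e * `|y| + C * d^-1 * `|v y| = C * (d * `|y| + d^-1 * `|v y|).
    by rewrite mulrDr !mulrA Cd.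
  by rewrite ler_pM2l//; exact: disc_lift_norm.
have gM : exists M : K, forall x, `|g x : K^o| <= M * `|x| by exists (C * d^-1).
by exists (make_operator (lg : linear (g : E -> K^o)) gM).
Qed.

Lemma finite_rank_lift (s : seq ('L(H : completeNormedModType K, K^o) * E)) (e : K) :
  0 < e -> exists2 S : 'L(E, E), finite_rank E E S &
    forall y, `|S (v y) - \sum_(i <- s) (i.1 (disc_lift y) : K) *: i.2| <= e * `|y|.
Proof.
elim: s e => [|[f z] s IH] e e0.
  exists 0; first by exists 0%N, (fun=> 0) => x; exists (fun=> 0); rewrite big_ord0.
  by move=> y; rewrite big_nil subr0 normr0 mulr_ge0// ltW.
have e20 : 0 < e / 2 by rewrite divr_gt0.
have z1 : 0 < `|z| + 1 by rewrite ltr_wpDl.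
have [S frS SE] := IH _ e20.
(* Multiplied by [|z|], which may be 0, this accuracy costs at most [e / 2 * |y|]; the other half
   goes to the remaining terms. *)
have [g gf] := functional_lift f (divr_gt0 e20 z1).
exists (rank_one g z + S); first exact: finite_rankD_rank_one.
move=> y; have -> : (rank_one g z + S) (v y) = (g (v y) : K) *: z + S (v y) by [].
rewrite big_cons /=.
rewrite opprD addrACA -scalerBl; apply: le_trans (ler_normD _ _) _.
rewrite [e in leRHS]splitr mulrDl lerD// normrZ.
apply: le_trans (ler_wpM2r (normr_ge0 z) (gf y)) _.
rewrite mulrAC ler_wpM2r// -mulrA ger_pMr// mulrC ler_pdivrMr// mul1r.
by rewrite lerDl.
Qed.

Lemma approximate_identity_on_image (J : operator_ideal K) :
  grothendieck_property J -> ideal_class J F E v ->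
  approximation_property (bounded_class J) finite_rank norm_topology E ->
  forall e, 0 < e -> exists2 S : 'L(E, E), finite_rank E E S &
    forall y, `|y| <= 1 -> `|S (v y) - v y| <= e.
Proof.
move=> GJ Jv apE e e0.
have [M M0 vM] := operator_bound v.
have e20 : 0 < e / 2 by rewrite divr_gt0.
have M1 : 0 < 1 + M by rewrite addr_gt0.
have L1j : bounded_class J H E disc_operator.
  apply/bounded_classP; apply: bounded_subsetsS (tapered_set_bounded_subsets GJ Jv).
  by move=> _ [x x1 <-]; exact: (@disc_space_unit_ball _ _ _ tapered_disc).
(* For [|y| <= 1] the gauge of [v y] is at most [1 + M], by [disc_lift_norm] at 1, so [w] costs
   [e / 2] there. *)
have /norm_closureP - /(_ K_scalars _ (divr_gt0 e20 M1))[w frw wj] := apE _ _ L1j.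
have [s ws] := finite_rank_decomposition K_scalars frw.
have [S frS Sw] := finite_rank_lift s e20.
exists S => // y y1.
rewrite -[S (v y)](subrK (w (disc_lift y))) -addrA.
apply: le_trans (ler_normD _ _) _; rewrite [e]splitr; apply: lerD.
  by rewrite ws; apply: le_trans (Sw y) _; rewrite ger_pMr.
apply: le_trans (wj _) _; rewrite mulrAC ler_pdivrMr// ler_pM2l//.
apply: le_trans (disc_lift_norm y ltr01) _.
rewrite mul1r invr1 mul1r lerD//.
by apply: le_trans (vM y) _; rewrite ger_pMr.
Qed.

End ApproximateIdentity.

(** * The equivalence of the four approximation properties *)

Theorem theorem3p11 (K : numFieldType) (K_scalars : real_or_complex K)
    (I J1 J2 : operator_ideal K)
    (J1_grothendieck : grothendieck_property J1)
    (L1_sub_I : forall F G : completeNormedModType K,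
      bounded_class J1 F G `<=` ideal_class I F G)
    (L1_factor : forall F G : completeNormedModType K,
      bounded_class J1 F G =
      comp_class (bounded_class J1) (bounded_class J2) F G)
    (I_maps : forall (F G : completeNormedModType K) (u : 'L(F, G)) (A : set F),
      ideal_class I F G u -> bounded_subsets J2 F A -> bounded_subsets J1 G (u @` A))
    (E : completeNormedModType K) :
  [<-> operator_closure (uniform_topology J1) E E (finite_rank E E)
         (id_operator E);
       approximation_property (bounded_class J1) finite_rank norm_topology E;
       approximation_property (bounded_class J1) finite_rank
         (uniform_topology J2) E;
       approximation_property I finite_rank (uniform_topology J2) E].
Proof.
have norm_of_identity :
    operator_closure (uniform_topology J1) E E (finite_rank E E) (id_operator E) ->
    approximation_property (bounded_class J1) finite_rank norm_topology E.
  move=> /(uniform_closureP K_scalars) idE F T /bounded_classP JT.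
  apply/norm_closureP => // e e0; have [S frS ST] := idE _ _ JT e0.
  exists (comp_operator S T); first exact: finite_rank_comp.
  apply: (@unit_ball_bound _ _ _ (comp_operator S T - T)) => x x1.
  by apply: ST; exists x.
have identity_of_norm :
    approximation_property (bounded_class J1) finite_rank norm_topology E ->
    operator_closure (uniform_topology J1) E E (finite_rank E E) (id_operator E).
  move=> apE; apply/uniform_closureP => // B e [F [v [Jv Bv]]] e0.
  have [S frS Sv] :=
    approximate_identity_on_image K_scalars J1_grothendieck Jv apE e0.
  by exists S => // _ /Bv[y y1 <-]; exact: Sv.
(* Factoring [T = R S] turns approximation on [J2]-bounded sets into norm approximation: the image
   of the unit ball under [S] is [J2]-bounded, and [R] is approximated on it. *)
have norm_of_uniform :
    approximation_property (bounded_class J1) finite_rank (uniform_topology J2) E ->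
    approximation_property (bounded_class J1) finite_rank norm_topology E.
  move=> apE F T; rewrite L1_factor => -[G [R [S [L1R /bounded_classP L2S ->]]]].
  apply/norm_closureP => // e e0.
  have /(uniform_closureP K_scalars)/(_ _ _ L2S e0)[Q frQ QR] := apE _ _ L1R.
  exists (comp_operator Q S); first exact: finite_rank_comp.
  apply: (@unit_ball_bound _ _ _ (comp_operator Q S - comp_operator R S)) => x x1.
  by apply: QR; exists x.
(* An operator of [I] carries the [J2]-bounded set to a [J1]-bounded one, where the identity is
   approximated. *)
have uniform_of_identity :
    operator_closure (uniform_topology J1) E E (finite_rank E E) (id_operator E) ->
    approximation_property I finite_rank (uniform_topology J2) E.
  move=> /(uniform_closureP K_scalars) idE F T IT.
  apply/uniform_closureP => // B e J2B e0.
  have [S frS ST] := idE _ _ (I_maps F E T B IT J2B) e0.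
  exists (comp_operator S T); first exact: finite_rank_comp.
  by move=> x Bx; apply: ST; exists x.
tfae.
- exact: norm_of_identity.
- move=> apE F T L1T; apply/uniform_closureP => // B e J2B e0.
  have [M M0 BM] := bounded_subsets_bounded J2B.
  have /(norm_closureP K_scalars)/(_ _ (divr_gt0 e0 M0))[S frS ST] := apE _ _ L1T.
  exists S => // x Bx; apply: le_trans (ST x) _.
  by rewrite mulrAC ler_pdivrMr// ler_pM2l//; exact: BM.
(* From (c) the way to (d) leads back through (b) to (a), and then through [uniform_of_identity]. *)
- by move=> /norm_of_uniform/identity_of_norm.
- move=> apE; apply/identity_of_norm/norm_of_uniform => F T L1T.
  exact/apE/L1_sub_I.
Qed.
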